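(* Fix $\rho_k>0$ and let $\{x_\ell\}$, $\{B_\ell\}$, $\{d_\ell\}$, $\{r_\ell\}$ be the infinite sequences generated by the inner SQP iteration described in the context (run without its stopping test). Suppose that $\{x_\ell\}$ lies in an open bounded subset of $\mathbb R^n$ and that the symmetric matrices $\{B_\ell\}$ are uniformly bounded and uniformly positive definite. Then $\{P_{\rho_k}(x_\ell)\}$ is bounded below and $\lim_{\ell\to\infty}\|d_\ell\|=0$. That is, for any given $\epsilon>0$, the stopping test $r_\ell\ge-\epsilon$ is satisfied after a finite number of iterations.
   Context: Let $f:\mathbb R^n\to\mathbb R$, $h:\mathbb R^n\to\mathbb R^{m_E}$, $g:\mathbb R^n\to\mathbb R^{m_I}$ be twice continuously differentiable (data of the problem: minimize $f(x)$ subject to $h(x)=0$, $g(x)\ge0$). $\nabla h(x)$, $\nabla g(x)$ are the matrices whose columns are the gradients of the components; $\max$ is componentwise. Let $c(x)=\|h(x)\|_1+\|\max\{0,-g(x)\}\|_1$ and $P_\rho(x)=\rho f(x)+c(x)$. Inner SQP iteration with fixed $\rho_k>0$, constants $\sigma,\tau\in(0,1)$: at $x_\ell$, with symmetric positive definite $B_\ell$, solve the QP $$\min_{d,y^+,z^+}\ \sum_i y_i^++\sum_i z_i^++\rho_k\nabla f(x_\ell)^Td+\tfrac12d^TB_\ell d$$ subject to $y^+-h(x_\ell)-\nabla h(x_\ell)^Td\ge0$, $y^++h(x_\ell)+\nabla h(x_\ell)^Td\ge0$, $z^++g(x_\ell)+\nabla g(x_\ell)^Td\ge0$, $z^+\ge0$,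 to get $(d_\ell,y_\ell^+,z_\ell^+)$. Set $r_\ell=\|y_\ell^+\|_1+\|z_\ell^+\|_1-c(x_\ell)$ and $P'_{\rho_k}(x_\ell;d_\ell):=\rho_k\nabla f(x_\ell)^Td_\ell+r_\ell$. Let $\alpha_\ell=\tau^{\imath}$ with $\imath\ge0$ the smallest integer such that $P_{\rho_k}(x_\ell+\tau^\imath d_\ell)-P_{\rho_k}(x_\ell)\le\sigma\tau^\imath P'_{\rho_k}(x_\ell;d_\ell)$, and put $x_{\ell+1}=x_\ell+\alpha_\ell d_\ell$; then choose $B_{\ell+1}$. *)

(* Defs.v *)
From HB Require Import structures.
From mathcomp Require Import all_boot all_order all_algebra.
From mathcomp Require Import all_classical all_reals all_analysis.

Set Implicit Arguments.
Unset Strict Implicit.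
Unset Printing Implicit Defensive.

Import Order.TTheory GRing.Theory Num.Theory.
Import numFieldNormedType.Exports.

Local Open Scope classical_set_scope.
Local Open Scope ring_scope.

(** Vectors of R^n are row vectors, so that the library Jacobian ['J h x], of
    type ['M[R]_(n, m)], is the matrix whose columns are the gradients of the
    components of [h], and [d *m 'J h x] is the transpose of
    (nabla h(x))^T d. *)

Section Calculus.
Context {R : realType}.

Definition dot n (u v : 'rV[R]_n) : R := \sum_(i < n) u ord0 i * v ord0 i.
Definition norm1 n (v : 'rV[R]_n) : R := \sum_(i < n) `|v ord0 i|.
(** The library norm [`|v|] on matrices is the max-norm. *)
Definition norm2 n (v : 'rV[R]_n) : R := Num.sqrt (dot v v).

(** v^T B v *)
Definition qform n (B : 'M[R]_n) (v : 'rV[R]_n) : R := dot (v *m B) v.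

Definition posdefmx n (B : 'M[R]_n) : Prop :=
  forall v : 'rV[R]_n, v != 0 -> 0 < qform B v.

Definition uniformly_posdef n (B : nat -> 'M[R]_n) : Prop :=
  exists2 mu : R, 0 < mu &
    forall l (v : 'rV[R]_n), mu * norm2 v ^+ 2 <= qform (B l) v.

Definition grad n (f : 'rV[R]_n -> R) (x : 'rV[R]_n) : 'rV[R]_n :=
  \row_(i < n) 'D_(delta_mx ord0 i) f x.

(** As R^n is finite-dimensional, continuity of x |-> Df(x) in the operator norm
    is continuity of x |-> Df(x) v for every direction v. *)
Definition continuously_differentiable n (V : normedModType R)
    (F : 'rV[R]_n -> V) : Prop :=
  (forall x, differentiable F x) /\ (forall v, continuous ('D_v F)).

Definition twice_continuously_differentiable n (V : normedModType R)
    (F : 'rV[R]_n -> V) : Prop :=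
  continuously_differentiable F /\
  (forall v, continuously_differentiable ('D_v F)).

End Calculus.

Section SQP.
Context {R : realType} {n mE mI : nat}.
Variables (f : 'rV[R]_n -> R) (h : 'rV[R]_n -> 'rV[R]_mE)
  (g : 'rV[R]_n -> 'rV[R]_mI) (rho : R).

Definition infeas (x : 'rV[R]_n) : R :=
  norm1 (h x) + norm1 (map_mx (Num.max 0) (- g x)).

Definition penalty (x : 'rV[R]_n) : R := rho * f x + infeas x.

Definition qp_feasible (x d : 'rV[R]_n) (y : 'rV[R]_mE) (z : 'rV[R]_mI) : Prop :=
  [/\ forall i, 0 <= (y - h x - d *m 'J h x) ord0 i,
      forall i, 0 <= (y + h x + d *m 'J h x) ord0 i,
      forall i, 0 <= (z + g x + d *m 'J g x) ord0 i &
      forall i, 0 <= z ord0 i].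

Definition qp_objective (x : 'rV[R]_n) (B : 'M[R]_n)
    (d : 'rV[R]_n) (y : 'rV[R]_mE) (z : 'rV[R]_mI) : R :=
  \sum_(i < mE) y ord0 i + \sum_(i < mI) z ord0 i
  + rho * dot (grad f x) d + 2^-1 * qform B d.

Definition qp_solution (x : 'rV[R]_n) (B : 'M[R]_n)
    (d : 'rV[R]_n) (y : 'rV[R]_mE) (z : 'rV[R]_mI) : Prop :=
  qp_feasible x d y z /\
  forall d' y' z', qp_feasible x d' y' z' ->
    qp_objective x B d y z <= qp_objective x B d' y' z'.

(** P'_rho(x; d) with [r] the residual r_l of the iteration. *)
Definition model_slope (x d : 'rV[R]_n) (r : R) : R :=
  rho * dot (grad f x) d + r.

Definition armijo (sigma tau : R) (x d : 'rV[R]_n) (r : R) (i : nat) : Prop :=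
  penalty (x + tau ^+ i *: d) - penalty x
    <= sigma * tau ^+ i * model_slope x d r.

(** The infinite run, without the stopping test; [B] is arbitrary apart from
    being symmetric positive definite at each iteration. *)
Record inner_sqp_run (sigma tau : R) (x : nat -> 'rV[R]_n) (B : nat -> 'M[R]_n)
    (d : nat -> 'rV[R]_n) (y : nat -> 'rV[R]_mE) (z : nat -> 'rV[R]_mI)
    (r alpha : nat -> R) : Prop := InnerSqpRun {
  run_sym : forall l, B l \is symmetricmx;
  run_posdef : forall l, posdefmx (B l);
  run_qp : forall l, qp_solution (x l) (B l) (d l) (y l) (z l);
  run_residual : forall l, r l = norm1 (y l) + norm1 (z l) - infeas (x l);
  run_linesearch : forall l, exists i : nat,
    [/\ armijo sigma tau (x l) (d l) (r l) i,
        forall j : nat, (j < i)%N -> ~ armijo sigma tau (x l) (d l) (r l) j &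
        alpha l = tau ^+ i];
  run_step : forall l, x l.+1 = x l + alpha l *: d l
}.

End SQP.

(* Main.v *)
Require Import Defs.
From HB Require Import structures.
From mathcomp Require Import all_boot all_order all_algebra.
From mathcomp Require Import all_classical all_reals all_analysis.
From mathcomp Require Import ring lra.

Set Implicit Arguments.
Unset Strict Implicit.
Unset Printing Implicit Defensive.

Import Order.TTheory GRing.Theory Num.Theory.
Import numFieldNormedType.Exports.

Local Open Scope classical_set_scope.
Local Open Scope ring_scope.

(** The point (0, |h|, max(0,-g)) is feasible for the QP with objective value
    c(x), so P'(x;d) <= - d^T B d / 2 <= - mu/2 ||d||^2.  Since moreover
    r >= - L ||d||, the steps d_l are bounded.  Convexity of the l1 terms and a
    second-order Taylor bound on a compact ball containing the points x_l + t d_l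
    give P(x + t d) - P(x) <= t P'(x;d) + C t^2 ||d||^2, hence the Armijo test
    holds as soon as t <= (1 - sigma) mu / (2 C), and alpha_l is bounded away
    from 0.  Each iteration thus decreases P by at least a fixed multiple of
    ||d_l||^2, and P is bounded below along the iterates, so d_l --> 0. *)

(** * Comparison of the max, l1 and Euclidean norms *)

Section Norms.
Context {R : realType}.

Lemma le_coord_norm n (v : 'rV[R]_n) i : `|v ord0 i| <= `|v|.
Proof.
rewrite [leRHS]/Num.Def.normr/= mx_normrE.
exact: (le_bigmax _ (fun ij => `|v ij.1 ij.2|) (ord0, i)).
Qed.

Lemma norm1_le n (v : 'rV[R]_n) : norm1 v <= n%:R * `|v|.
Proof.
have -> : n%:R * `|v| = \sum_(i < n) `|v| by rewrite sumr_const card_ord mulr_natl.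
by apply: ler_sum => i _; exact: le_coord_norm.
Qed.

Lemma norm1_ge0 n (v : 'rV[R]_n) : 0 <= norm1 v.
Proof. by apply: sumr_ge0. Qed.

Lemma dotvv_ge0 n (v : 'rV[R]_n) : 0 <= dot v v.
Proof. by apply: sumr_ge0 => i _; rewrite -expr2 sqr_ge0. Qed.

Lemma norm2_ge0 n (v : 'rV[R]_n) : 0 <= norm2 v.
Proof. exact: sqrtr_ge0. Qed.

Lemma norm_le_norm2 n (v : 'rV[R]_n) : `|v| <= norm2 v.
Proof.
rewrite [leLHS]/Num.Def.normr/= mx_normrE bigmax_le ?norm2_ge0// => -[a i] _ /=.
rewrite (ord1 a) -sqrtr_sqr ler_sqrt ?dotvv_ge0// /dot (bigD1 i)//= -expr2.
by rewrite lerDl sumr_ge0// => j _; rewrite -expr2 sqr_ge0.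
Qed.

End Norms.

(** * Uniform derivative and Taylor bounds on balls *)

Section CompactBounds.
Context {R : realType} {n : nat}.
Implicit Types (V : normedModType R) (x v : 'rV[R]_n).

Lemma bounded_on_ball V (F : 'rV[R]_n -> V) (M : R) : continuous F ->
  exists2 C, 0 <= C & forall x, `|x| <= M -> `|F x| <= C.
Proof.
move=> cF; pose A := [set x : 'rV[R]_n | `|x| <= M].
have cA : compact A.
  apply: bounded_closed_compact.
    by exists M; split; [exact: num_real|move=> N MN x /le_trans; apply; exact: ltW].
  have -> : A = closed_ball_ Num.norm 0 M.
    by apply/seteqP; split => x; rewrite /A /closed_ball_/= sub0r normrN.
  exact: closed_closed_ball_.
have /compact_bounded [C [_ HC]] : compact (F @` A).
  by apply: continuous_compact => //; exact: continuous_subspaceT.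
(* Boundedness supplies bounds strictly above [C] only, hence [C + 1]; the maximum with 0 secures
   nonnegativity. *)
exists (Num.max 0 (C + 1)) => [|x xM]; first by rewrite le_max lexx.
apply: HC; first by rewrite lt_max ltrDl ltr01 orbT.
by exists x.
Qed.

Lemma derive_row_sum V (F : 'rV[R]_n -> V) x v : differentiable F x ->
  'D_v F x = \sum_(i < n) v ord0 i *: 'D_(delta_mx ord0 i) F x.
Proof.
move=> dF; rewrite deriveE// [in LHS](row_sum_delta v) linear_sum.
by apply: eq_bigr => i _; rewrite linearZ deriveE.
Qed.

Lemma dot_gradE (F : 'rV[R]_n -> R) x v : differentiable F x ->
  dot (grad F x) v = 'D_v F x.
Proof.
move=> dF; rewrite derive_row_sum//; apply: eq_bigr => i _.
by rewrite mxE mulrC.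
Qed.

(** By linearity in [v] it suffices to bound the [n] partial derivatives, each continuous and hence
    bounded on the ball. *)
Lemma derive_bounded V (F : 'rV[R]_n -> V) (M : R) :
  continuously_differentiable F ->
  exists2 C, 0 <= C & forall x v, `|x| <= M -> `|'D_v F x| <= C * `|v|.
Proof.
move=> [dF cF].
have /fin_all_exists2[C C0 HC] (i : 'I_n) :=
  bounded_on_ball M (cF (delta_mx ord0 i)).
exists (\sum_i C i) => [|x v xM]; first exact: sumr_ge0.
rewrite derive_row_sum// (le_trans (ler_norm_sum _ _ _))// mulr_suml.
apply: ler_sum => i _; rewrite normrZ mulrC ler_pM// ?le_coord_norm//.
exact: HC.
Qed.

(** For fixed [v], ['D_v F] is a constant combination of partial derivatives. Differentiating it
    termwise gives one factor of size [|v|] from the coefficients and another from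
    [derive_bounded]. *)
Lemma derive2_bounded V (F : 'rV[R]_n -> V) (M : R) :
  twice_continuously_differentiable F ->
  exists2 C, 0 <= C &
    forall x v, `|x| <= M -> `|'D_v ('D_v F) x| <= C * `|v| ^+ 2.
Proof.
move=> [[dF _] cdF].
have /fin_all_exists2[C C0 HC] (i : 'I_n) :=
  derive_bounded M (cdF (delta_mx ord0 i)).
exists (\sum_i C i) => [|x v xM]; first exact: sumr_ge0.
have -> : 'D_v F = \sum_(i < n) (v ord0 i \*: 'D_(delta_mx ord0 i) F).
  by apply/funext => u; rewrite derive_row_sum// fct_sumE.
have dD i : derivable ('D_(delta_mx ord0 i) F) x v.
  by apply: diff_derivable; case: (cdF (delta_mx ord0 i)).
rewrite derive_sum => [|i]; last exact: derivableZ.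
rewrite (le_trans (ler_norm_sum _ _ _))// mulr_suml.
apply: ler_sum => i _; rewrite deriveZ// normrZ.
rewrite expr2 mulrCA ler_pM// ?le_coord_norm//.
exact: HC.
Qed.

(** The difference quotient of the restriction to the line is, as a function of the increment, the
    directional difference quotient of [F]. *)
Lemma is_derive_line V (F : 'rV[R]_n -> V) x v (s : R) :
  differentiable F (x + s *: v) ->
  is_derive s 1 (fun t : R => F (x + t *: v)) ('D_v F (x + s *: v)).
Proof.
move=> dF.
have E : (fun h : R => h^-1 *: (((fun t : R => F (x + t *: v)) \o shift s) (h *: (1:R)) -
    F (x + s *: v))) =
  (fun h => h^-1 *: ((F \o shift (x + s *: v)) (h *: v) - F (x + s *: v))).
  apply/funext => h /=; congr (_ *: (F _ - _)).
  by rewrite scalerDl [h%:A]mulr1 addrCA addrC -addrA addrC.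
have dv := diff_derivable (v := v) dF.
by apply: DeriveDef; rewrite /derivable /derive E.
Qed.

(** Two mean value steps: [F] on [[0, t]] yields a point [c], then ['D_v F] on [[0, c]] yields [e],
    so the remainder is [t * c] times a second derivative, with [c <= t]. *)
Lemma taylor2_bounded (F : 'rV[R]_n -> R) (M N : R) :
  twice_continuously_differentiable F ->
  exists2 C, 0 <= C &
    forall x v (t : R), `|x| <= M -> `|v| <= N -> 0 <= t <= 1 ->
    `|F (x + t *: v) - F x - t * 'D_v F x| <= C * (t ^+ 2 * `|v| ^+ 2).
Proof.
move=> F2; have [[dF _] cdF] := F2.
(* The radius [M + N] covers every intermediate point [x + e *: v] with [0 <= e <= 1]. *)
have [C C0 HC] := derive2_bounded (M + N) F2.
exists C => // x v t xM vN /andP[t0 t1].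
have line (G : 'rV[R]_n -> R) (s : R) : (forall u, differentiable G u) -> 0 <= s ->
    exists2 c, c \in `[0, s]%R & G (x + s *: v) - G x = 'D_v G (x + c *: v) * s.
  move=> dG s0.
  have [||c cs] := @MVT_segment R (fun t => G (x + t *: v))
    (fun t => 'D_v G (x + t *: v)) 0 s s0.
  - by move=> u _; exact: is_derive_line.
  - apply: continuous_subspaceT => u; apply: differentiable_continuous.
    apply/derivable1_diffP; exact: (@ex_derive _ _ _ _ _ _ _ (is_derive_line (dG _))).
  - by rewrite scale0r addr0 subr0 => E; exists c.
have [c + ->] := line F t dF t0.
rewrite in_itv/= => /andP[c0 ct].
rewrite mulrC -mulrBr.
have [e + ->] := line ('D_v F) c (fun u => (cdF v).1 u) c0.
rewrite in_itv/= => /andP[e0 ec].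
rewrite !normrM (ger0_norm t0) (ger0_norm c0).
have : `|'D_v ('D_v F) (x + e *: v)| <= C * `|v| ^+ 2.
  apply: HC; rewrite (le_trans (ler_normD _ _))// lerD// normrZ ger0_norm//.
  by rewrite (le_trans _ vN)// ler_piMl// (le_trans ec)// (le_trans ct).
move=> HD.
have -> : C * (t ^+ 2 * `|v| ^+ 2) = t * (C * `|v| ^+ 2 * t) by ring.
by rewrite ler_wpM2l// ler_pM.
Qed.

Lemma derive_coord m (F : 'rV[R]_n -> 'rV[R]_m) (i : 'I_m) x v :
  differentiable F x -> 'D_v (fun u => F u ord0 i) x = 'D_v F x ord0 i.
Proof. by move=> dF; rewrite derive_mx ?mxE//; exact: diff_derivable. Qed.

Lemma continuously_differentiable_coord m (F : 'rV[R]_n -> 'rV[R]_m) (i : 'I_m) :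
  continuously_differentiable F ->
  continuously_differentiable (fun u => F u ord0 i).
Proof.
move=> [dF cF]; split=> [x|v].
  by apply: (@differentiable_comp _ _ _ _ F (fun N : 'rV[R]_m => N ord0 i)) => //;
    exact: differentiable_coord.
have -> : 'D_v (fun u => F u ord0 i) = (fun N : 'rV[R]_m => N ord0 i) \o 'D_v F.
  by apply/funext => x /=; rewrite derive_coord.
move=> x; apply: continuous_comp; first exact: cF.
exact: coord_continuous.
Qed.

Lemma twice_continuously_differentiable_coord m (F : 'rV[R]_n -> 'rV[R]_m)
    (i : 'I_m) :
  twice_continuously_differentiable F ->
  twice_continuously_differentiable (fun u => F u ord0 i).
Proof.
move=> [cF cdF]; split; first exact: continuously_differentiable_coord.
move=> v.
have -> : 'D_v (fun u => F u ord0 i) = (fun u => 'D_v F u ord0 i).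
  by apply/funext => x /=; rewrite derive_coord//; case: cF.
exact: continuously_differentiable_coord.
Qed.

(** The mean value argument is scalar, so it is applied to each component and the constants are
    summed. *)
Lemma taylor2_bounded_norm1 m (F : 'rV[R]_n -> 'rV[R]_m) (M N : R) :
  twice_continuously_differentiable F ->
  exists2 C, 0 <= C &
    forall x v (t : R), `|x| <= M -> `|v| <= N -> 0 <= t <= 1 ->
    norm1 (F (x + t *: v) - F x - t *: 'D_v F x) <= C * (t ^+ 2 * `|v| ^+ 2).
Proof.
move=> F2.
have /fin_all_exists2[C C0 HC] (i : 'I_m) :=
  taylor2_bounded M N (twice_continuously_differentiable_coord i F2).
exists (\sum_i C i) => [|x v t xM vN t01]; first exact: sumr_ge0.
rewrite mulr_suml; apply: ler_sum => i _.
have := HC i x v t xM vN t01.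
by rewrite derive_coord ?mxE; last by case: F2 => -[].
Qed.

End CompactBounds.

(** [u] is nonincreasing and bounded below, so it converges and its consecutive differences vanish;
    [v] is squeezed between 0 and those differences divided by [k]. *)
Lemma sufficient_decrease_cvg0 {R : realType} (u v : nat -> R) (m k : R) :
  0 < k -> (forall l, m <= u l) -> (forall l, 0 <= v l) ->
  (forall l, u l.+1 - u l <= - (k * v l)) ->
  v l @[l --> \oo] --> (0 : R).
Proof.
move=> k0 mu v0 dec.
have cu : cvgn u.
  apply: nonincreasing_is_cvgn.
    apply/nonincreasing_seqP => l; rewrite -subr_le0.
    by rewrite (le_trans (dec l))// oppr_le0 mulr_ge0// ltW.
  by exists m => _ [l _ <-].
have du : (k^-1 * (u l - u l.+1)) @[l --> \oo] --> (0 : R).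
  rewrite -(mulr0 k^-1) -(subrr (limn u)); apply: cvgMr.
  by apply: cvgB => //; rewrite (cvg_shiftS u).
apply: (squeeze_cvgr _ (cvg_cst 0) du).
near=> l; rewrite v0/= ler_pdivlMl//.
have := dec l; lra.
Unshelve. all: by end_near. Qed.

(** * Consequences of QP feasibility and optimality for the penalty function *)

Section QPStep.
Context {R : realType} {n mE mI : nat}.
Variables (f : 'rV[R]_n -> R) (h : 'rV[R]_n -> 'rV[R]_mE)
  (g : 'rV[R]_n -> 'rV[R]_mI) (rho : R).
Hypotheses (hf : twice_continuously_differentiable f)
  (hh : twice_continuously_differentiable h)
  (hg : twice_continuously_differentiable g) (rho_gt0 : 0 < rho).
Implicit Types (x d : 'rV[R]_n) (y : 'rV[R]_mE) (z : 'rV[R]_mI).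

Lemma infeas_ge0 x : 0 <= infeas h g x.
Proof. by rewrite addr_ge0 ?norm1_ge0. Qed.

Lemma qp_feasible_eq x d y z i : qp_feasible h g x d y z ->
  `|h x ord0 i + 'D_d h x ord0 i| <= y ord0 i.
Proof.
case=> /(_ i) + /(_ i) + _ _.
rewrite -deriveEjacobian; last by case: hh => -[].
by rewrite !mxE ler_norml => ? ?; lra.
Qed.

Lemma qp_feasible_ineq x d y z i : qp_feasible h g x d y z ->
  0 <= z ord0 i /\ - (g x ord0 i + 'D_d g x ord0 i) <= z ord0 i.
Proof.
case=> _ _ /(_ i) + /(_ i).
rewrite -deriveEjacobian; last by case: hg => -[].
by rewrite !mxE => ? ?; split; lra.
Qed.

(** Feasibility forces [y] and [z] to be nonnegative. This links the sums in the QP objective to the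
    l1 norms in the residual. *)
Lemma qp_feasible_norm1 x d y z : qp_feasible h g x d y z ->
  norm1 y = \sum_(i < mE) y ord0 i /\ norm1 z = \sum_(i < mI) z ord0 i.
Proof.
move=> F; split; apply: eq_bigr => i _; rewrite ger0_norm//.
  exact: le_trans (qp_feasible_eq i F).
by case: (qp_feasible_ineq i F).
Qed.

Lemma qp_feasible0 x :
  qp_feasible h g x 0 (map_mx Num.norm (h x)) (map_mx (Num.max 0) (- g x)).
Proof.
split=> i; rewrite ?mul0mx !mxE ?subr0 ?addr0 ?le_max ?lexx//.
- by rewrite subr_ge0 ler_norm.
- by rewrite -lerBlDr sub0r -normrN ler_norm.
- by rewrite -lerBlDr sub0r le_max lexx orbT.
Qed.

Lemma qp_solution_slope x (B : 'M[R]_n) d y z :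
  qp_solution f h g rho x B d y z ->
  model_slope f rho x d (norm1 y + norm1 z - infeas h g x)
    <= - (2^-1 * qform B d).
Proof.
move=> [F opt].
have := opt _ _ _ (qp_feasible0 x).
have [Ey Ez] := qp_feasible_norm1 F.
have [Ey0 Ez0] := qp_feasible_norm1 (qp_feasible0 x).
rewrite /qp_objective /model_slope -Ey -Ez -Ey0 -Ez0.
(* At the null step the quadratic and gradient terms vanish, so the competing objective value is
   exactly [infeas h g x]. *)
have -> : qform B 0 = 0.
  by rewrite /qform mul0mx /dot big1// => i _; rewrite !mxE mulr0.
have -> : dot (grad f x) 0 = 0 by rewrite /dot big1// => i _; rewrite !mxE mulr0.
have -> : norm1 (map_mx Num.norm (h x)) = norm1 (h x).
  by apply: eq_bigr => i _; rewrite mxE normr_id.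
rewrite /infeas; lra.
Qed.

(** The linearization at [t *: d] is the convex combination of its values at 0 and at [d], the
    latter controlled by the slacks. Convexity of the absolute value and of the positive part then
    leaves only the Taylor remainders. *)
Lemma infeas_step_le x d y z (t : R) : qp_feasible h g x d y z -> 0 <= t <= 1 ->
  infeas h g (x + t *: d) <=
    (1 - t) * infeas h g x + t * (norm1 y + norm1 z)
    + norm1 (h (x + t *: d) - h x - t *: 'D_d h x)
    + norm1 (g (x + t *: d) - g x - t *: 'D_d g x).
Proof.
move=> F /andP[t0 t1].
have [-> ->] := qp_feasible_norm1 F.
have Hh : norm1 (h (x + t *: d)) <= (1 - t) * norm1 (h x)
    + t * \sum_(i < mE) y ord0 i + norm1 (h (x + t *: d) - h x - t *: 'D_d h x).
  rewrite /norm1 !mulr_sumr -!big_split/=; apply: ler_sum => i _.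
  have := qp_feasible_eq i F; rewrite !mxE.
  set a := h x _ _; set b := 'D_d h x _ _; set c := h _ _ _ => Hy.
  have -> : c = (1 - t) * a + t * (a + b) + (c - a - t * b) by ring.
  rewrite (le_trans (ler_normD _ _))// lerD//.
    rewrite (le_trans (ler_normD _ _))// !normrM (ger0_norm t0).
    by rewrite (@ger0_norm _ (1 - t)) ?subr_ge0// lerD2l ler_wpM2l.
  by rewrite le_eqVlt; apply/orP; left; apply/eqP; congr `|_|; ring.
have Hg : norm1 (map_mx (Num.max 0) (- g (x + t *: d))) <=
    (1 - t) * norm1 (map_mx (Num.max 0) (- g x))
    + t * \sum_(i < mI) z ord0 i + norm1 (g (x + t *: d) - g x - t *: 'D_d g x).
  rewrite /norm1 !mulr_sumr -!big_split/=; apply: ler_sum => i _.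
  have [] := qp_feasible_ineq i F; rewrite !mxE.
  set a := g x _ _; set b := 'D_d g x _ _; set c := g _ _ _ => z0 Hz.
  have pos (w : R) : `|Num.max 0 w| = Num.max 0 w.
    by rewrite ger0_norm// le_max lexx.
  rewrite !pos ge_max; apply/andP; split.
    by rewrite !addr_ge0// mulr_ge0// ?subr_ge0// le_max lexx.
  have -> : - c = (1 - t) * - a + t * (- (a + b)) - (c - a - t * b) by ring.
  rewrite lerD// ?lerD// ?ler_wpM2l ?subr_ge0// ?le_max ?lexx ?orbT//.
  by rewrite -normrN ler_norm.
rewrite /infeas; lra.
Qed.

Lemma penalty_step_le (M N : R) : exists2 C, 0 < C &
  forall x d y z (t : R), `|x| <= M -> `|d| <= N -> 0 <= t <= 1 ->
    qp_feasible h g x d y z ->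
    penalty f h g rho (x + t *: d) - penalty f h g rho x <=
      t * model_slope f rho x d (norm1 y + norm1 z - infeas h g x)
      + C * (t ^+ 2 * `|d| ^+ 2).
Proof.
have [Cf Cf0 Hf] := taylor2_bounded M N hf.
have [Ch Ch0 Hh] := taylor2_bounded_norm1 M N hh.
have [Cg Cg0 Hg] := taylor2_bounded_norm1 M N hg.
(* The added 1 makes the constant positive, since the step-length threshold divides by it. *)
exists (rho * Cf + Ch + Cg + 1); first by rewrite ltr_wpDl// !addr_ge0// mulr_ge0// ltW.
move=> x d y z t xM dN t01 F.
have Ef := le_trans (ler_norm _) (Hf x d t xM dN t01).
have := infeas_step_le F t01.
have := Hh x d t xM dN t01; have := Hg x d t xM dN t01.
rewrite /penalty /model_slope dot_gradE; last by case: hf => -[].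
have : 0 <= t ^+ 2 * `|d| ^+ 2 by rewrite mulr_ge0 ?sqr_ge0.
move: (t ^+ 2 * _) Ef => e Ef e0 Eg Eh Einf.
have := ler_wpM2l (ltW rho_gt0) Ef.
lra.
Qed.

(** By the triangle inequality the slacks undercut the current violation by at most the size of the
    linear terms in [d]. This serves both to bound the QP steps and to reach the stopping test. *)
Lemma residual_ge (M : R) : exists2 L, 0 <= L &
  forall x d y z, `|x| <= M -> qp_feasible h g x d y z ->
    - (L * `|d|) <= norm1 y + norm1 z - infeas h g x.
Proof.
have [Ch Ch0 Hh] := derive_bounded M (proj1 hh).
have [Cg Cg0 Hg] := derive_bounded M (proj1 hg).
(* The dimensions come from bounding the l1 norm by the max-norm. *)
exists (mE%:R * Ch + mI%:R * Cg); first by rewrite addr_ge0// mulr_ge0.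
move=> x d y z xM F; have [-> ->] := qp_feasible_norm1 F.
have Eh : norm1 (h x) <= \sum_(i < mE) y ord0 i + norm1 ('D_d h x).
  rewrite /norm1 -big_split; apply: ler_sum => i _ /=.
  have := qp_feasible_eq i F.
  set a := h x _ _; set b := 'D_d h x _ _ => Hy.
  have := ler_normB (a + b) b; rewrite addrK; lra.
have Eg : norm1 (map_mx (Num.max 0) (- g x)) <=
    \sum_(i < mI) z ord0 i + norm1 ('D_d g x).
  rewrite /norm1 -big_split; apply: ler_sum => i _ /=.
  have [] := qp_feasible_ineq i F; rewrite !mxE.
  set a := g x _ _; set b := 'D_d g x _ _ => z0 Hz.
  rewrite ger0_norm ?le_max ?lexx// ge_max addr_ge0//=.
  have := ler_norm b; lra.
have := le_trans (norm1_le _) (ler_wpM2l (ler0n _ _) (Hh x d xM)).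
have := le_trans (norm1_le _) (ler_wpM2l (ler0n _ _) (Hg x d xM)).
rewrite /infeas; lra.
Qed.

(** The slope is at least [- K * |d|] and at most [- mu / 2 * |d|^2]; a nonzero [d] can be cancelled
    once, giving [|d| <= 2 * K / mu]. *)
Lemma qp_step_bounded (M mu : R) : 0 < mu -> exists N : R,
  forall x (B : 'M[R]_n) d y z, `|x| <= M ->
    mu * norm2 d ^+ 2 <= qform B d -> qp_solution f h g rho x B d y z ->
    `|d| <= N.
Proof.
move=> mu0.
have [Cf Cf0 Hf] := derive_bounded M (proj1 hf).
have [L L0 HL] := residual_ge M.
pose K := rho * Cf + L.
have K0 : 0 <= K by rewrite addr_ge0// mulr_ge0// ltW.
exists (2 * K / mu) => x B d y z xM dB S.
have := qp_solution_slope S; have := HL _ _ _ _ xM S.1.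
rewrite /model_slope dot_gradE; last by case: hf => -[].
have := Hf x d xM; rewrite ler_norml => /andP[+ _].
have [->|d0] := eqVneq d 0; first by rewrite normr0 divr_ge0 ?mulr_ge0// ltW.
move=> /(ler_wpM2l (ltW rho_gt0)) D1 D2 D3.
have D4 : mu * `|d| ^+ 2 <= mu * norm2 d ^+ 2.
  by rewrite ler_pM2l// lerXn2r ?nnegrE// ?norm2_ge0// norm_le_norm2.
have : (mu * `|d|) * `|d| <= (2 * K) * `|d| by rewrite /K; lra.
by rewrite ler_pM2r ?normr_gt0// ler_pdivlMr// mulrC.
Qed.

End QPStep.

(** With [t = tau ^+ i], the test reduces to [(1 - sigma) * P' + C * t * |d|^2 <= 0]. The slope
    bound makes the first term at most [- (1 - sigma) * mu / 2] times the squared Euclidean norm,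
    which the threshold on [t] lets absorb the second. *)
Lemma armijo_small_step {R : realType} (n mE mI : nat)
    (f : 'rV[R]_n -> R) (h : 'rV[R]_n -> 'rV[R]_mE) (g : 'rV[R]_n -> 'rV[R]_mI)
    (rho sigma tau mu C r : R) (x d : 'rV[R]_n) (i : nat) :
  sigma < 1 -> 0 < tau -> 0 < C ->
  model_slope f rho x d r <= - (2^-1 * (mu * norm2 d ^+ 2)) ->
  penalty f h g rho (x + tau ^+ i *: d) - penalty f h g rho x <=
    tau ^+ i * model_slope f rho x d r + C * ((tau ^+ i) ^+ 2 * `|d| ^+ 2) ->
  tau ^+ i <= (1 - sigma) * mu / (2 * C) ->
  armijo f h g rho sigma tau x d r i.
Proof.
move=> s1 t0 C0 slope step; rewrite ler_pdivlMr ?mulr_gt0// /armijo => small.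
apply: (le_trans step); have := exprn_gt0 i t0.
move: (tau ^+ i) (model_slope _ _ _ _ _) small slope => t P small slope t_gt0.
have dd : `|d| ^+ 2 <= norm2 d ^+ 2.
  by rewrite lerXn2r ?nnegrE// ?norm2_ge0// norm_le_norm2.
have d0 : 0 <= `|d| ^+ 2 by rewrite sqr_ge0.
have tC : 0 <= t * C by rewrite mulr_ge0// ltW.
have H1 : t * C * `|d| ^+ 2 <= t * C * norm2 d ^+ 2 by rewrite ler_wpM2l.
have H2 : t * (2 * C) * norm2 d ^+ 2 <= (1 - sigma) * mu * norm2 d ^+ 2.
  by rewrite ler_wpM2r// sqr_ge0.
have H3 : (1 - sigma) * P <= (1 - sigma) * - (2^-1 * (mu * norm2 d ^+ 2)).
  by rewrite ler_wpM2l// subr_ge0 ltW.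
have : t * ((1 - sigma) * P + C * t * `|d| ^+ 2) <= t * 0.
  by rewrite ler_wpM2l ?(ltW t_gt0)//; lra.
lra.
Qed.

Theorem theorem5p4 (R : realType) (n mE mI : nat)
    (f : 'rV[R]_n -> R) (h : 'rV[R]_n -> 'rV[R]_mE) (g : 'rV[R]_n -> 'rV[R]_mI)
    (hf : twice_continuously_differentiable f)
    (hh : twice_continuously_differentiable h)
    (hg : twice_continuously_differentiable g)
    (rho sigma tau : R) (hrho : 0 < rho)
    (hsigma : 0 < sigma < 1) (htau : 0 < tau < 1)
    (x : nat -> 'rV[R]_n) (B : nat -> 'M[R]_n) (d : nat -> 'rV[R]_n)
    (y : nat -> 'rV[R]_mE) (z : nat -> 'rV[R]_mI) (r alpha : nat -> R)
    (hrun : inner_sqp_run f h g rho sigma tau x B d y z r alpha)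
    (hx : exists U : set 'rV[R]_n,
        [/\ open U, bounded_set U & forall l, U (x l)])
    (hBbd : bounded_set (range B))
    (hBpd : uniformly_posdef B) :
  [/\ has_lbound (range (fun l => penalty f h g rho (x l))),
      norm2 (d l) @[l --> \oo] --> (0 : R) &
      forall eps : R, 0 < eps -> exists l, - eps <= r l].
Proof.
have [_ _ qp res lsearch step] := hrun.
have [/andP[s0 s1] /andP[t0 t1]] := (hsigma, htau).
have [M xM] : exists M, forall l, `|x l| <= M.
  have [U [_ [M [_ UM]] xU]] := hx.
  by exists (M + 1) => l; apply: UM => //; rewrite ltrDl.
have [mu mu0 Bmu] := hBpd.
(* The infeasibility is nonnegative and [f] is bounded on the ball containing the iterates. *)
have [m Pm] : exists m, forall l, m <= penalty f h g rho (x l).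
  have [Cf _ Hf] := bounded_on_ball M
    (fun u => differentiable_continuous ((proj1 hf).1 u)).
  exists (- (rho * Cf)) => l; rewrite -mulrN -[leLHS]addr0 lerD ?infeas_ge0//.
  by rewrite ler_pM2l//; have := Hf _ (xM l); rewrite ler_norml => /andP[].
have [N HN] := qp_step_bounded hf hh hg hrho M mu0.
have dN l : `|d l| <= N := HN _ _ _ _ _ (xM l) (Bmu l (d l)) (qp l).
have [C C0 HC] := penalty_step_le hf hh hg hrho M N.
have slope l : model_slope f rho (x l) (d l) (r l)
    <= - (2^-1 * (mu * norm2 (d l) ^+ 2)).
  by rewrite res (le_trans (qp_solution_slope hh hg (qp l)))// lerN2 ler_pM2l//.
pose a1 := (1 - sigma) * mu / (2 * C).
have a1_gt0 : 0 < a1 by rewrite divr_gt0 ?mulr_gt0 ?subr_gt0.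
have small l i : tau ^+ i <= a1 -> armijo f h g rho sigma tau (x l) (d l) (r l) i.
  apply: (armijo_small_step s1 t0 C0 (slope l)); rewrite res.
  apply: HC (xM l) (dN l) _ (qp l).1.
  by rewrite exprn_ge0 ?exprn_ile1 // ltW.
(* Either the full step is accepted, or the preceding trial [tau ^+ i] failed and so exceeds [a1];
   one more factor [tau] gives the accepted step. *)
pose a0 := Num.min 1 (tau * a1).
have a0_gt0 : 0 < a0 by rewrite lt_min ltr01 mulr_gt0.
have alpha_ge l : a0 <= alpha l.
  have [[|i] [_ fails ->]] := lsearch l; first by rewrite ge_min expr0 lexx.
  rewrite ge_min exprS ler_pM2l// orbC; apply/orP; left.
  by rewrite leNgt; apply/negP => /ltW/(small l); exact: fails (ltnSn i).
(* The slope is negative or zero, so the lower bound [a0] on the step length turns the Armijo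
   inequality into a uniform decrease. *)
have decrease l : penalty f h g rho (x l.+1) - penalty f h g rho (x l)
    <= - (sigma * a0 * (2^-1 * mu) * norm2 (d l) ^+ 2).
  have [i [arm _ alphaE]] := lsearch l.
  rewrite step alphaE (le_trans arm)// -alphaE -!mulrA -mulrN ler_pM2l//.
  have nonneg : 0 <= 2^-1 * (mu * norm2 (d l) ^+ 2).
    by rewrite mulr_ge0 ?invr_ge0// mulr_ge0 ?sqr_ge0// ltW.
  have := ler_wpM2r nonneg (alpha_ge l).
  have := ler_wpM2l (le_trans (ltW a0_gt0) (alpha_ge l)) (slope l).
  lra.
have d2_cvg0 : norm2 (d l) ^+ 2 @[l --> \oo] --> (0 : R).
  apply: (sufficient_decrease_cvg0 _ Pm _ decrease) => [|l].
    by rewrite !mulr_gt0.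
  exact: sqr_ge0.
have d_cvg0 : norm2 (d l) @[l --> \oo] --> (0 : R).
  have : Num.sqrt (norm2 (d l) ^+ 2) @[l --> \oo] --> Num.sqrt (0 : R).
    by apply: continuous_cvg => //; exact: sqrt_continuous.
  by rewrite sqrtr0; under eq_fun do rewrite sqrtr_sqr ger0_norm ?norm2_ge0//.
split=> // [|eps eps0]; first by exists m => _ [l _ <-].
have [L L0 HL] := residual_ge hh hg M.
(* Once the norm is below [eps / (L + 1)], [residual_ge] gives [r l >= - eps]; [L + 1] keeps the
   denominator positive when [L = 0]. *)
have /cvgr_lt/(_ (eps / (L + 1))) := d_cvg0.
rewrite divr_gt0 ?ltr_wpDl// => /(_ isT)[l _ /(_ l (leqnn l))/= dl].
exists l; rewrite res (le_trans _ (HL _ _ _ _ (xM l) (qp l).1))// lerN2.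
rewrite ltr_pdivlMr ?ltr_wpDl// in dl.
rewrite (le_trans _ (ltW dl))// mulrC ler_pM// ?lerDl//.
exact: norm_le_norm2.
Qed.
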